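(* Let $\mathcal{G}=(\mathcal{V},\mathcal{E})$ be a cell graph with $\mathcal{V}=\{1,\dots,n\}$, and consider admissible functions of the form $$f(x)=\sum_{e\in\mathcal{E}}\phi(x_{\rho(e)},x_{\tau(e)}),\qquad x=(x_1,\dots,x_n)\in(\mathbb{R}^k)^n,$$ with smooth coupling function $\phi:\mathbb{R}^{2k}\to\mathbb{R}$. For a generic coupling function $\phi$ the following holds. Let $(x_0,y_0)\in\mathbb{R}^k\times\mathbb{R}^k$, $x_0\neq y_0$, be a critical point of $\phi$, and let $\bar x=(x_1,\dots,x_n)$ be a point with $x_i\in\{x_0,y_0\}$ for all $i=1,\dots,n$. Then $\bar x$ can be a critical point of $f$ only if $\mathcal{G}$ is bipartite. In this case, for the bipartition $\mathcal{V}=\mathcal{V}_1\,\dot\cup\,\mathcal{V}_2$ (with a suitable labelling of the two parts), $\bar x$ is given by $$x_i=\begin{cases}x_0,& i\in\mathcal{V}_1,\\ y_0,& i\in\mathcal{V}_2.\end{cases}$$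
   Context: A cell graph is a finite connected undirected graph without multiple edges (not necessarily regular); loops are disregarded, so $\mathcal{E}$ is the set of edges joining distinct vertices. For each edge $e$, $\rho(e)$ and $\tau(e)$ denote its two endpoints in a fixed order. $I(v)$ is the set of neighbours of $v$ and $d(v)=|I(v)|$. A smooth function $f:(\mathbb{R}^k)^n\to\mathbb{R}$ is admissible if for each degree $d$ there is a function $\tilde f_d$ such that for every vertex $v$ with $I(v)=\{u_1,\dots,u_{d(v)}\}$, $\partial f/\partial x_v(x)=\tilde f_{d(v)}(x_v,x_{u_1},\dots,x_{u_{d(v)}})$ with $\tilde f_{d(v)}$ invariant under permutations of the last $d(v)$ arguments. The coupling function $\phi$ may be $\mathbf{Z}_2$-invariant ($\phi(x,y)=\phi(y,x)$) or not. ''For a generic coupling function'' means: for all $\phi$ in a residual subset (Whitney $C^\infty$ topology) of the space of smooth functions under consideration, namely the space of all smooth functions $\mathbb{R}^{2k}\to\mathbb{R}$ or the space of all smooth $\mathbf{Z}_2$-invariant functions $\mathbb{R}^{2k}\to\mathbb{R}$. *)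

(* Defs.v *)
From HB Require Import structures.
From mathcomp Require Import all_boot all_order all_algebra all_fingroup.
From mathcomp Require Import all_classical all_reals all_analysis.
Set Implicit Arguments.
Unset Strict Implicit.
Unset Printing Implicit Defensive.
Import Order.TTheory GRing.Theory Num.Theory.
Import numFieldNormedType.Exports.
Local Open Scope classical_set_scope.
Local Open Scope ring_scope.

(* R^k is 'rV[R]_k and R^(2k) is 'rV[R]_(k + k), a pair (x, y) being
   row_mx x y; a point x of (R^k)^n is a matrix in 'M[R]_(n, k) whose i-th
   row is x_i.  Calculus is set up for 'M[R]_(m, n), which covers all of them. *)

Section Calculus.
Variables (R : realType) (m n : nat).
Implicit Types f : 'M[R]_(m, n) -> R.

Definition partial (ij : 'I_m * 'I_n) f : 'M[R]_(m, n) -> R :=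
  fun x => 'D_(delta_mx ij.1 ij.2) f x.

Definition partials (s : seq ('I_m * 'I_n)) f : 'M[R]_(m, n) -> R :=
  foldr partial f s.

(* 'D_v f x has an unspecified value when the derivative does not exist, hence
   the explicit derivability requirement. *)
Definition smooth f : Prop :=
  forall s : seq ('I_m * 'I_n), continuous (partials s f) /\
    forall ij x, derivable (partials s f) x (delta_mx ij.1 ij.2).

Definition critical_point f (x : 'M[R]_(m, n)) : Prop :=
  forall ij, partial ij f x = 0.

Definition block_gradient f (v : 'I_m) (x : 'M[R]_(m, n)) : 'rV[R]_n :=
  \row_j partial (v, j) f x.

End Calculus.

Section Whitney.
Variables (R : realType) (m n : nat) (S : set ('M[R]_(m, n) -> R)).

Record smooth_space : Type := SmoothSpace {
  smooth_fun :> 'M[R]_(m, n) -> R;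
  smooth_funP : smooth smooth_fun;
  smooth_fun_in : S smooth_fun }.

HB.instance Definition _ := gen_eqMixin smooth_space.
HB.instance Definition _ := gen_choiceMixin smooth_space.

Definition whitney_ball (f : smooth_space) (r : nat) (delta : 'M[R]_(m, n) -> R)
    : set smooth_space :=
  [set g : smooth_space | forall s : seq ('I_m * 'I_n), (size s <= r)%N ->
     forall x, `|partials s g x - partials s f x| < delta x].

(* The Whitney C^oo topology on the smooth functions belonging to S, i.e. the
   subspace topology: f has the sets whitney_ball f r delta, with r : nat and
   delta a positive continuous function, as a neighbourhood basis. *)
Definition whitney_open (U : set smooth_space) : Prop :=
  forall f, U f -> exists (r : nat) (delta : 'M[R]_(m, n) -> R),
    [/\ continuous delta, forall x, 0 < delta x & whitney_ball f r delta `<=` U].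

Lemma whitney_openT : whitney_open setT.
Proof. by move=> f _; exists 0%N, (cst 1); split=> // x; exact: cst_continuous. Qed.

Lemma whitney_openI : setI_closed whitney_open.
Proof.
move=> A B oA oB f [/oA[r [d [cd d0 dA]]] /oB[r' [d' [cd' d'0 dB]]]].
exists (maxn r r'), (fun x => Num.min (d x) (d' x)); split.
- by move=> x; apply: continuous_min; [exact: cd|exact: cd'].
- by move=> x; rewrite lt_min d0 d'0.
- move=> g gf; split; [apply: dA|apply: dB] => s rs x.
  + have := gf s (leq_trans rs (leq_maxl r r')) x.
    by rewrite lt_min => /andP[].
  + have := gf s (leq_trans rs (leq_maxr r r')) x.
    by rewrite lt_min => /andP[].
Qed.

Lemma whitney_open_bigU (I : Type) (F : I -> set smooth_space) :
  (forall i, whitney_open (F i)) -> whitney_open (\bigcup_i F i).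
Proof.
move=> oF f [i _ /oF[r [d [cd d0 dF]]]]; exists r, d; split=> // g /dF Fg.
by exists i.
Qed.

HB.instance Definition _ := @isOpenTopological.Build smooth_space whitney_open
  whitney_openT whitney_openI whitney_open_bigU.

End Whitney.

Definition residual (T : topologicalType) (A : set T) : Prop :=
  exists2 F : nat -> set T, (forall i, open (F i) /\ dense (F i)) &
    \bigcap_i F i `<=` A.

Definition Z2_invariant (R : realType) (k : nat) : set ('rV[R]_(k + k) -> R) :=
  [set phi | forall x y : 'rV[R]_k, phi (row_mx x y) = phi (row_mx y x)].

Section CellGraphs.
Variable n : nat.
Implicit Types (E : {set {set 'I_n}}) (u v : 'I_n).

Definition edge_rel E : rel 'I_n := fun u v => [set u; v]%SET \in E.

Definition neighbours E v : {set 'I_n} := [set u | edge_rel E v u]%SET.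

(* Edges are unordered pairs of distinct vertices, so loops and multiple edges
   are excluded. *)
Definition cell_graph E : Prop :=
  [/\ (0 < n)%N, forall e, e \in E -> #|e| = 2%N
    & forall u v, connect (edge_rel E) u v].

Definition edge_endpoints E (rho tau : {set 'I_n} -> 'I_n) : Prop :=
  forall e, e \in E -> e = [set rho e; tau e]%SET.

Definition bipartition E (V1 V2 : {set 'I_n}) : Prop :=
  V2 = (~: V1)%SET /\
  forall e, e \in E -> #|(e :&: V1)%SET| = 1%N /\ #|(e :&: V2)%SET| = 1%N.

Definition bipartite E : Prop := exists V1 V2, bipartition E V1 V2.

(* u ranges over the enumerations u_1, ..., u_d of the d neighbours of v. *)
Definition admissible (R : realType) (k : nat) E (f : 'M[R]_(n, k) -> R) : Prop :=
  smooth f /\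
  forall d : nat, exists ft : 'rV[R]_k -> ('I_d -> 'rV[R]_k) -> 'rV[R]_k,
    (forall y (z : 'I_d -> 'rV[R]_k) (s : 'S_d),
       ft y (fun i => z (s i)) = ft y z) /\
    forall v (u : 'I_d -> 'I_n),
      injective u -> [set u i | i in 'I_d]%SET = neighbours E v ->
      forall x, block_gradient f v x = ft (row v x) (fun i => row (u i) x).

Definition coupled_sum (R : realType) (k : nat) E (rho tau : {set 'I_n} -> 'I_n)
    (phi : 'rV[R]_(k + k) -> R) : 'M[R]_(n, k) -> R :=
  fun x => \sum_(e in E) phi (row_mx (row (rho e) x) (row (tau e) x)).

Definition two_valued (R : realType) (k : nat) (x0 y0 : 'rV[R]_k)
    (V1 V2 : {set 'I_n}) (x : 'M[R]_(n, k)) : Prop :=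
  (forall i, i \in V1 -> row i x = x0) /\ (forall i, i \in V2 -> row i x = y0).

End CellGraphs.

(* Main.v *)
Require Import Defs.
From mathcomp Require Import all_boot all_order all_algebra all_fingroup.
From mathcomp Require Import all_classical all_reals all_analysis.
From mathcomp Require Import ring lra.
Import Order.TTheory GRing.Theory Num.Theory.
Import numFieldNormedType.Exports.
Local Open Scope classical_set_scope.
Local Open Scope ring_scope.
Set Implicit Arguments.
Unset Strict Implicit.
Unset Printing Implicit Defensive.

(** The heart of the matter is a transversality statement. Suppose that an edge
    joins two vertices at which [x] takes the same value [u], one of [x0], [y0],
    and let [v] be its first endpoint. In the partial gradient of the coupled sum
    at [v], every edge contributes a derivative of [phi] at [(u, u)], at
    [(x0, y0)] or at [(y0, x0)]. The derivatives at the critical point [(x0, y0)]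
    vanish, so one coordinate of this gradient has the form
      a * d_1 phi(u, u) + b * d_2 phi(u, u) + c * d_s phi(y0, x0)
    with natural numbers [a > 0], [b], [c] ([two_valued_partial]). If [phi] is
    symmetric then [(y0, x0)] is critical as well and [c] may be taken to be [0].
    Generically no such combination vanishes at a critical point
    ([generic_vertex_probe]), so along every edge the value of [x] changes between
    [x0] and [y0]. The set of vertices with value [x0] is then one part of a
    bipartition, and connectedness makes the bipartition unique
    ([crosses_unique]).

    For the genericity, the condition that [z = (x0, y0)] be critical with a
    vanishing combination is a system of 2k + 1 equations in 2k unknowns.
    Countably many small cubes [Q] with rational centres cover the set where
    [x0 <> y0], and there are countably many triples [(a, b, c)], so it suffices
    that for each cube and each triple the functions with no solution in [Q] form
    an open dense set. Openness is compactness of [Q] ([open_avoids]). For density,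
    add to [phi] a combination, with coefficients [p], of 2k + 1 compactly
    supported functions which on [Q] move the 2k + 1 equations independently: on
    the cube the bad [p] are the values of a Lipschitz map from [Q] to R^(2k+1),
    and such a map misses points arbitrarily close to [0], by counting
    ([lipschitz_image_misses], [dense_avoids]). The 2k + 1 functions are coordinate
    functions cut off by bumps around [Q] and around its image on the diagonal
    ([test_map_perturbation]); since [x0 <> y0] on [Q], the three relevant points
    are separated and the bumps do not interfere. *)

(** * Directional derivatives and flat functions *)

Section Lines.
Variables (R : realType) (V : normedModType R).

(** This reduces directional derivatives to one-variable calculus: both sides are
    limits of the same difference quotient. *)
Lemma is_derive_lineP (f : V -> R) (v x : V) (t df : R) :
  is_derive (t *: v + x) v f df <-> is_derive t 1 (fun s => f (s *: v + x)) df.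
Proof.
suff E : (fun h : R => h^-1 *: ((f \o shift (t *: v + x)) (h *: v)
            - f (t *: v + x))) =
    (fun h : R => h^-1 *: (((fun s => f (s *: v + x)) \o shift t) (h *: 1)
            - f (t *: v + x))).
  by split=> -[d <-]; apply: DeriveDef; move: d; rewrite /derivable /derive E.
apply/funext => h /=; congr (_ *: (f _ - _)).
by rewrite [_%:A]mulr1 scalerDl addrA.
Qed.

Lemma is_derive_comp_line (g : R -> R) (f : V -> R) (v x : V) (dg df : R) :
  is_derive (f x) 1 g dg -> is_derive x v f df ->
  is_derive x v (g \o f) (dg * df).
Proof.
move=> g' f'.
have E : x = 0 *: v + x by rewrite scale0r add0r.
rewrite E; apply/is_derive_lineP.
apply: (@is_derive1_comp _ g (fun s => f (s *: v + x)) 0 dg df).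
  by rewrite -E.
by apply/is_derive_lineP; rewrite -E.
Qed.

End Lines.

Section Flat.
Variable R : realType.
Implicit Types (p : {poly R}) (t s : R).

(** These functions, one for each polynomial, form a family closed under
    derivation ([is_derive_flat]); [flat 1] is the classical function
    exp(-1/t). *)
Definition flat p t : R := if 0 < t then p.[t^-1] * expR (- t^-1) else 0.

Lemma flat_gt0 p t : 0 < t -> flat p t = p.[t^-1] * expR (- t^-1).
Proof. by rewrite /flat => ->. Qed.

Lemma flat_le0 p t : t <= 0 -> flat p t = 0.
Proof. by rewrite /flat ltNge => ->. Qed.

Lemma horner_norm_le p s : 1 <= s ->
  `|p.[s]| <= (\sum_(i < size p) `|p`_i|) * s ^+ size p.
Proof.
move=> s1; rewrite horner_coef (le_trans (ler_norm_sum _ _ _))// mulr_suml.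
apply: ler_sum => i _; rewrite normrM ler_wpM2l// normrX ger0_norm ?(le_trans _ s1)//.
by rewrite ler_weXn2l// ltnW.
Qed.

(** The exponential beats every power: with n = size p and s = 1/t >= 1, the bound
    e^s >= s^(n+1) / (n+1)! leaves a factor 1/s = t. *)
Lemma flat_le p : exists2 C, 0 <= C &
  forall t, t <= 1 -> `|flat p t| <= C * `|t|.
Proof.
set n := size p.
exists ((\sum_(i < n) `|p`_i|) * (n.+1)`!%:R).
  by rewrite mulr_ge0// sumr_ge0.
move=> t t1; have [t0|t0] := leP t 0.
  by rewrite flat_le0// normr0 !mulr_ge0// sumr_ge0.
rewrite flat_gt0// normrM expRN (ger0_norm (x := (expR _)^-1)) ?invr_ge0 ?expR_ge0//.
have s1 : 1 <= t^-1 by rewrite invf_ge1.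
have s0 : 0 < t^-1 by rewrite invr_gt0.
have e_ge : t^-1 ^+ n.+1 / (n.+1)`!%:R <= expR t^-1.
  by apply: le_trans (expR_ge1Dxn n (ltW s0)); rewrite lerDr.
have f0 : 0 < (n.+1)`!%:R :> R by rewrite ltr0n fact_gt0.
rewrite ler_pdivrMr ?expR_gt0// (le_trans (horner_norm_le p s1))//.
rewrite -/n -!mulrA ler_wpM2l ?sumr_ge0// (gtr0_norm t0).
apply: le_trans (_ : (n.+1)`!%:R * (t * (t^-1 ^+ n.+1 / (n.+1)`!%:R)) <= _).
  rewrite [t * _]mulrA exprS [t * (_ * _)]mulrA divff ?gt_eqF// mul1r.
  by rewrite mulrCA divff ?gt_eqF// mulr1.
by rewrite ler_pM2l// ler_pM2l.
Qed.

Lemma is_derive_flat p t :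
  is_derive t 1 (flat p) (flat ('X^2 * (p - p^`())) t).
Proof.
have [t0|t0|->] := ltgtP t 0.
- rewrite flat_le0 ?ltW//.
  apply: (@near_eq_is_derive _ _ _ (cst 0)).
  near=> x; rewrite flat_le0// ltW//; near: x; exact: lt_nbhsl.
- rewrite flat_gt0//.
  have t_neq0 : t != 0 by rewrite gt_eqF.
  have dV : is_derive t 1 (fun x : R => x^-1) (- t ^- 2).
    apply: DeriveDef; first exact: (@derivableV _ _ id).
    by rewrite (@deriveV _ _ id)// derive_id [_%:A]mulr1.
  have dp : is_derive t 1 (fun x => p.[x^-1]) (p^`().[t^-1] * - t ^- 2).
    exact: (@is_derive1_comp _ (horner p) (fun x => x^-1)).
  have de : is_derive t 1 (fun x : R => expR (- x^-1)) (expR (- t^-1) * t ^- 2).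
    have dN : is_derive t 1 (fun x : R => - x^-1) (t ^- 2).
      by rewrite -[_ ^- 2]opprK; exact: is_deriveN.
    exact: (@is_derive1_comp _ expR (fun x => - x^-1)).
  have dpe : is_derive t 1 (fun x => p.[x^-1] * expR (- x^-1))
      (('X^2 * (p - p^`())).[t^-1] * expR (- t^-1)).
    apply: is_derive_eq.
    rewrite !hornerE/= /GRing.scale/= !exprVn; ring.
  apply: near_eq_is_derive dpe.
  near=> x; rewrite flat_gt0//; near: x; exact: lt_nbhsr.
- rewrite flat_le0//.
  (* The difference quotient of [flat p] at 0 is [flat ('X * p)]. *)
  suff lim0 : h^-1 *: ((flat p \o shift 0) (h *: 1) - flat p 0) @[h --> 0^'] --> 0.
    apply: DeriveDef; first by apply/cvg_ex; exists 0.
    exact: cvg_lim lim0.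
  have [C C0 flatC] := flat_le ('X * p).
  apply/cvgrPdist_le => e e0; near=> h.
  have h0 : h != 0 by near: h; exact: nbhs_dnbhs_neq.
  rewrite sub0r normrN /= addr0 [h%:A]mulr1 (flat_le0 _ (lexx 0)) subr0.
  have -> : h^-1 *: flat p h = flat ('X * p) h.
    rewrite /flat; case: ifP => _; last by rewrite [RHS]/= scaler0.
    by rewrite hornerM hornerX /GRing.scale/= mulrA.
  have hs : `|h| <= Num.min 1 (e / (C + 1)).
    near: h; apply: dnbhs0_le.
    by rewrite lt_min ltr01 divr_gt0// ltr_wpDl.
  move: hs; rewrite le_min => /andP[h1 he].
  apply: le_trans (flatC _ (le_trans (ler_norm h) h1)) _.
  apply: le_trans (_ : (C + 1) * `|h| <= e); first by rewrite ler_wpM2r// lerDl.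
  by rewrite mulrC -ler_pdivlMr// ltr_wpDl.
Unshelve. all: by end_near. Qed.

End Flat.

(** * Closure properties of smooth functions *)

Section SmoothCalculus.
Variables (R : realType) (m n : nat).
Implicit Types (f g : 'M[R]_(m, n) -> R) (ij : 'I_m * 'I_n)
  (s : seq ('I_m * 'I_n)) (x : 'M[R]_(m, n)).

Lemma partials_partial s ij f : partials s (partial ij f) = partials (rcons s ij) f.
Proof. by rewrite /partials foldr_rcons. Qed.

Lemma smooth_partial ij f : smooth f -> smooth (partial ij f).
Proof. by move=> sf s; rewrite partials_partial. Qed.

Lemma smooth_continuous f : smooth f -> continuous f.
Proof. by move=> /(_ [::])[]. Qed.

Lemma is_derive_partial f ij x :
  smooth f -> is_derive x (delta_mx ij.1 ij.2) f (partial ij f x).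
Proof. by move=> /(_ [::])[_ /(_ ij x) d]; exact: DeriveDef. Qed.

Lemma partials_local (O : set 'M[R]_(m, n)) f g : open O ->
  (forall x, O x -> f x = g x) ->
  forall s x, O x -> partials s f x = partials s g x.
Proof.
move=> oO fg s; elim: s => [|ij s IHs] x Ox; first exact: fg.
rewrite /= /partial; apply: near_eq_derive.
by apply: filterS (IHs) _; exact: open_nbhs_nbhs.
Qed.

(** Each constructor has derivatives of the same form, so that smoothness of all
    these functions follows at one stroke ([elementary_is_smooth]); sums, products
    and compositions with [flat p] of smooth functions are special cases. *)
Inductive elementary : ('M[R]_(m, n) -> R) -> Prop :=
| elementary_smooth f : smooth f -> elementary f
| elementary_cst c : elementary (cst c)
| elementary_coord i j : elementary (fun x => x i j)
| elementaryD f g : elementary f -> elementary g -> elementary (f \+ g)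
| elementaryM f g : elementary f -> elementary g -> elementary (f \* g)
| elementary_flat p f : elementary f -> elementary (flat p \o f).

Lemma is_derive_coord (i : 'I_m) (j : 'I_n) x (v : 'M[R]_(m, n)) :
  is_derive x v (fun x : 'M[R]_(m, n) => x i j) (v i j).
Proof.
have E : x = 0 *: v + x by rewrite scale0r add0r.
rewrite E; apply/is_derive_lineP.
have -> : (fun t : R => (t *: v + x) i j) = (fun t => v i j * t + x i j).
  by apply/funext => t; rewrite !mxE mulrC.
by apply: is_derive_eq; rewrite addr0 [_ *: _]mulr1.
Qed.

Lemma elementary_derive f : elementary f -> continuous f /\
  forall ij, exists2 f', elementary f' &
    forall x, is_derive x (delta_mx ij.1 ij.2) f (f' x).
Proof.
elim=> [g sg|c|i j|g h _ [cg dg] _ [ch dh]|g h eg [cg dg] eh [ch dh]|p g eg [cg dg]].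
- split=> [|ij]; first exact: smooth_continuous.
  exists (partial ij g) => [|x]; last exact: is_derive_partial.
  by apply/elementary_smooth/smooth_partial.
- split=> [|ij]; first exact: cst_continuous.
  by exists (cst 0) => [|x]; [exact: elementary_cst | exact: is_derive_cst].
- split=> [|ij]; first exact: coord_continuous.
  exists (cst ((delta_mx ij.1 ij.2 : 'M[R]_(m, n)) i j)) => [|x].
    exact: elementary_cst.
  exact: is_derive_coord.
- split=> [x|ij]; first exact: (continuousD (cg x) (ch x)).
  have [g' eg' dg'] := dg ij; have [h' eh' dh'] := dh ij.
  by exists (g' \+ h') => [|x]; [exact: elementaryD | exact: is_deriveD].
- split=> [x|ij]; first exact: (continuousM (cg x) (ch x)).
  have [g' eg' dg'] := dg ij; have [h' eh' dh'] := dh ij.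
  exists ((g \* h') \+ (h \* g')) => [|x].
    by apply: elementaryD; exact: elementaryM.
  exact: is_deriveM.
- have dflat x : is_derive (g x) 1 (flat p) (flat ('X^2 * (p - p^`())) (g x)).
    exact: is_derive_flat.
  split=> [x|ij].
    apply: continuous_comp; first exact: cg.
    apply: differentiable_continuous; apply/derivable1_diffP.
    by case: (dflat x).
  have [g' eg' dg'] := dg ij.
  exists ((flat ('X^2 * (p - p^`())) \o g) \* g') => [|x].
    by apply: elementaryM => //; exact: elementary_flat.
  exact: is_derive_comp_line.
Qed.

Lemma elementary_is_smooth f : elementary f -> smooth f.
Proof.
move=> ef s.
have es : elementary (partials s f).
  elim: s => [//|ij s /elementary_derive[_ /(_ ij)[f' ef' df']]] /=.
  suff -> : partial ij (partials s f) = f' by [].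
  by apply/funext => x; case: (df' x).
have [cs ds] := elementary_derive es; split=> // ij x.
by have [f' _ /(_ x)[]] := ds ij.
Qed.

Lemma smoothD f g : smooth f -> smooth g -> smooth (f + g).
Proof.
by move=> sf sg; apply/elementary_is_smooth/elementaryD; exact: elementary_smooth.
Qed.

Lemma smoothM f g : smooth f -> smooth g -> smooth (f \* g).
Proof.
by move=> sf sg; apply/elementary_is_smooth/elementaryM; exact: elementary_smooth.
Qed.

Lemma smooth_flat p f : smooth f -> smooth (flat p \o f).
Proof.
by move=> sf; apply/elementary_is_smooth/elementary_flat; exact: elementary_smooth.
Qed.

Lemma smooth_cst c : smooth (cst c : 'M[R]_(m, n) -> R).
Proof. exact/elementary_is_smooth/elementary_cst. Qed.

Lemma smooth_coord i j : smooth (fun x : 'M[R]_(m, n) => x i j).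
Proof. exact/elementary_is_smooth/elementary_coord. Qed.

Lemma smoothZ c f : smooth f -> smooth (c *: f).
Proof. by move=> sf; exact: (smoothM (smooth_cst c) sf). Qed.

Lemma smooth_sum N (p : 'I_N -> R) (psi : 'I_N -> 'M[R]_(m, n) -> R) :
  (forall j, smooth (psi j)) -> smooth (\sum_j p j *: psi j).
Proof.
move=> spsi; elim/big_rec: _ => [|j f _ sf]; first exact: smooth_cst.
exact/smoothD/sf/smoothZ.
Qed.

Lemma smooth_prod N (f : 'I_N -> 'M[R]_(m, n) -> R) :
  (forall j, smooth (f j)) -> smooth (fun x => \prod_j f j x).
Proof.
move=> sf; pose F (r : seq 'I_N) := fun x : 'M[R]_(m, n) => \prod_(j <- r) f j x.
suff : forall r, smooth (F r) by apply.
elim=> [|j r IHr].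
  have -> : F [::] = cst 1 by apply/funext => x; rewrite /F big_nil.
  exact: smooth_cst.
have -> : F (j :: r) = f j \* F r by apply/funext => x; rewrite /F big_cons.
exact: smoothM.
Qed.

Lemma partialsD s f g : smooth f -> smooth g ->
  partials s (f + g) = partials s f + partials s g.
Proof.
move=> sf sg; elim: s => //= ij s ->; apply/funext => x.
by rewrite /partial deriveD//; [case: (sf s)|case: (sg s)].
Qed.

Lemma partialsZ s c f : smooth f -> partials s (c *: f) = c *: partials s f.
Proof.
move=> sf; elim: s => //= ij s ->; apply/funext => x.
by rewrite /partial deriveZ//; case: (sf s).
Qed.

Lemma partials_sum s N (p : 'I_N -> R) (psi : 'I_N -> 'M[R]_(m, n) -> R) :
  (forall j, smooth (psi j)) ->
  partials s (\sum_j p j *: psi j) = \sum_j p j *: partials s (psi j).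
Proof.
move=> spsi; suff [] : smooth (\sum_j p j *: psi j) /\
  partials s (\sum_j p j *: psi j) = \sum_j p j *: partials s (psi j) by [].
elim/big_rec2: _ => [|j f f' _ [sf ff']].
  split; first exact: smooth_cst.
  by elim: s => //= ij s ->; apply/funext => x; rewrite /partial derive_cst.
split; first exact/smoothD/sf/smoothZ.
by rewrite partialsD ?partialsZ ?ff'//; exact: smoothZ.
Qed.

End SmoothCalculus.

(** * Cubes and Lipschitz maps *)

Section Cubes.
Variables (R : realType) (d : nat).
Implicit Types (f : 'rV[R]_d -> R) (q z : 'rV[R]_d) (e C t : R).

Definition cube q e : set 'rV[R]_d := [set z | forall i, `|z 0 i - q 0 i| <= e].

Lemma cube_compact q e : compact (cube q e).
Proof.
rewrite (_ : cube q e =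
    [set z : 'rV[R]_d | forall i, `[q 0 i - e, q 0 i + e]%classic (z 0 i)]).
  apply: (@rV_compact R d (fun i => `[q 0 i - e, q 0 i + e]%classic)) => i.
  exact: segment_compact.
by apply/seteqP; split=> z h i; have := h i; rewrite /= in_itv/= ler_distl.
Qed.

Lemma cube_center q e : 0 <= e -> cube q e q.
Proof. by move=> e0 i; rewrite subrr normr0. Qed.

Lemma cube_bounded q e f : continuous f ->
  exists2 M, 0 <= M & forall z, cube q e z -> `|f z| <= M.
Proof.
move=> cf; have [[z0 cz0]|/nonemptyPn E] := pselect (cube q e !=set0); last first.
  by exists 0 => // z; rewrite E.
have cnf : continuous (fun z => `|f z|).
  by move=> z; exact: (cvg_norm (cf z)).
have [c _ cM] := compact_EVT_max (ex_intro _ z0 cz0) (@cube_compact q e)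
  (continuous_subspaceT cnf).
by exists `|f c| => // z /mem_set/cM.
Qed.

(** Mean value theorem along a segment parallel to an axis; the segment stays in
    the cube by convexity. *)
Lemma coord_step f q e z i h (M : R) : smooth f ->
  (forall w, cube q e w -> `|partial (ord0, i) f w| <= M) ->
  cube q e z -> cube q e (h *: delta_mx ord0 i + z) ->
  `|f (h *: delta_mx ord0 i + z) - f z| <= M * `|h|.
Proof.
move=> sf fM cz ch; set v := delta_mx _ _.
pose F (s : R) := f ((h * s) *: v + z).
have dF (s : R) : is_derive s 1 F (partial (ord0, i) f ((h * s) *: v + z) * h).
  apply: (@is_derive1_comp _ (fun u : R => f (u *: v + z)) (fun s : R => h * s)).
    have /is_derive_lineP := is_derive_partial (ord0, i) ((h * s) *: v + z) sf.
    exact.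
  by apply: is_derive_eq; rewrite [_ *: _]mulr1.
have cF : {within `[0, 1], continuous F}.
  apply: derivable_within_continuous => s _; by case: (dF s).
have [c c01 E] := MVT_segment ler01 (fun s _ => dF s) cF.
have -> : f (h *: v + z) - f z = F 1 - F 0.
  by rewrite /F mulr1 mulr0 scale0r add0r.
rewrite E subr0 mulr1 normrM ler_wpM2r//; apply: fM => l.
move: c01; rewrite in_itv/= => /andP[c0 c1].
have := ch l; have := cz l; rewrite !mxE.
set a := (_ && _)%:R : R; move=> z1 z2.
have -> : h * c * a + z 0 l - q 0 l =
  (1 - c) * (z 0 l - q 0 l) + c * (h * a + z 0 l - q 0 l) by ring.
rewrite (le_trans (ler_normD _ _))// !normrM.
rewrite (ger0_norm c0) ger0_norm ?subr_ge0//.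
have -> : e = (1 - c) * e + c * e by ring.
by rewrite lerD// ler_wpM2l// subr_ge0.
Qed.

(** The path from [z'] to [z] changes one coordinate at a time, so that only
    partial derivatives are needed. *)
Lemma smooth_lipschitz f q e : smooth f -> exists2 C, 0 <= C &
  forall z z', cube q e z -> cube q e z' ->
  forall t, (forall i, `|z 0 i - z' 0 i| <= t) -> `|f z - f z'| <= C * t.
Proof.
move=> sf.
have /choice[M MP] (i : 'I_d) : exists M, 0 <= M /\
    forall w, cube q e w -> `|partial (ord0, i) f w| <= M.
  have [M] := cube_bounded q e (smooth_continuous (smooth_partial (ord0, i) sf)).
  by exists M.
exists (\sum_i M i); first by apply: sumr_ge0 => i _; have [] := MP i.
move=> z z' cz cz' t zz'.
pose w k : 'rV[R]_d := \row_i (if (i < k)%N then z 0 i else z' 0 i).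
have cw k : cube q e (w k) by move=> i; rewrite mxE; case: ifP.
have -> : z = w d by apply/rowP => i; rewrite mxE ltn_ord.
have -> : z' = w 0%N by apply/rowP => i; rewrite mxE.
rewrite -(telescope_sumr (fun k => f (w k)) (leq0n d)) big_mkord mulr_suml.
rewrite (le_trans (ler_norm_sum _ _ _))//; apply: ler_sum => i _.
have E : w i.+1 = (z 0 i - z' 0 i) *: delta_mx ord0 i + w i.
  apply/rowP => j; rewrite !mxE/= ltnS leq_eqVlt.
  have [->|ji] := eqVneq j i.
    by rewrite eqxx ltnn/= mulr1 subrK.
  have -> : (j == i :> nat) = false by apply/negbTE; exact: ji.
  by rewrite mulr0 add0r.
have [M0 MPi] := MP i.
rewrite E (le_trans (coord_step sf MPi _ _)) -?E//.
by rewrite ler_wpM2l.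
Qed.

(** Were every [p] attained, then so would be the M^(d+1) points of a grid of mesh
    eta / M. Cut the cube into (A M)^d cells: for A large compared with the
    Lipschitz constant, two points of one cell have images closer than the mesh,
    so distinct grid points come from distinct cells and M^(d+1) <= (A M)^d, which
    fails as soon as M > A^d. *)
Lemma lipschitz_image_misses (g : 'rV[R]_d -> 'I_d.+1 -> R) q e C eta :
  0 < e -> 0 <= C -> 0 < eta ->
  (forall z z', cube q e z -> cube q e z' ->
    forall t, (forall i, `|z 0 i - z' 0 i| <= t) ->
    forall a, `|g z a - g z' a| <= C * t) ->
  exists2 p : 'I_d.+1 -> R, (forall a, 0 <= p a <= eta) &
    forall z, cube q e z -> exists a, g z a != p a.
Proof.
move=> e0 C0 eta0 gC; apply: contrapT => noP.
pose K := C * (2 * e) / eta.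
have K0 : 0 <= K by rewrite divr_ge0 ?mulr_ge0 // ltW.
pose A := (Num.truncn K).+3.
have AK : K + 2 < A%:R.
  have := truncnS_gt K; rewrite /A -[(_.+3)%:R]natr1 -[(_.+2)%:R]natr1; lra.
pose M := (A ^ d).+1.
(* Rounding down the coordinates in [0, N] gives N + 1 = A * M labels. *)
pose N := (A * M).-1.
have NE : N.+1 = (A * M)%N by rewrite /N prednK.
have M1 : 1 <= M%:R :> R by rewrite ler1n.
have M0 : 0 < M%:R :> R by rewrite ltr0n.
have NK : K * M%:R < N%:R.
  have : N%:R + 1 = A%:R * M%:R :> R by rewrite natr1 NE natrM.
  have : (K + 2) * M%:R < A%:R * M%:R by rewrite ltr_pM2r.
  by rewrite mulrDl; lra.
have N0 : 0 < N%:R :> R by apply: le_lt_trans NK; rewrite mulr_ge0.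
pose p (c : {ffun 'I_d.+1 -> 'I_M}) a : R := eta * ((c a)%:R / M%:R).
have /choice[Z ZP] c : exists z, cube q e z /\ forall a, g z a = p c a.
  apply: contrapT => nz; apply: noP; exists (p c) => [a|z cz].
    rewrite /p; apply/andP; split; first by rewrite mulr_ge0 ?divr_ge0// ltW.
    by rewrite ger_pMr// ler_pdivrMr// mul1r ler_nat ltnW.
  apply: contrapT => ga; apply: nz; exists z; split=> // a.
  by apply/eqP/negPn/negP => na; apply: ga; exists a.
pose u (z : 'rV[R]_d) i : R := N%:R * ((z 0 i - q 0 i + e) / (2 * e)).
have u0N z i : cube q e z -> 0 <= u z i <= N%:R.
  move=> /(_ i); rewrite ler_norml => /andP[h1 h2].
  rewrite /u mulr_ge0 ?divr_ge0//=; [|lra|lra].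
  by rewrite ger_pMr// ler_pdivrMr; lra.
pose cell c : {ffun 'I_d -> 'I_N.+1} := [ffun i => inord (Num.truncn (u (Z c) i))].
have cellE c i : cell c i = Num.truncn (u (Z c) i) :> nat.
  rewrite ffunE inordK// ltnS; have /andP[u0 uN] := u0N _ i (ZP c).1.
  by rewrite -(ler_nat R) (le_trans _ uN)// truncn_le.
have : injective cell.
  move=> c c' cc'; apply/ffunP => a; apply/eqP/negPn/negP => ca.
  have [cz gz] := ZP c; have [cz' gz'] := ZP c'.
  have zz' i : `|Z c 0 i - Z c' 0 i| <= 2 * e / N%:R.
    have /andP[u0 _] := u0N _ i cz; have /andP[u0' _] := u0N _ i cz'.
    have := cellE c i; rewrite cc' cellE => E.
    have := truncn_itv u0; have := truncn_itv u0'.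
    rewrite E -natr1 => /andP[l1 l2] /andP[l1' l2'].
    rewrite ler_pdivlMr// -(ler_pM2r (x := (2 * e)^-1)) ?invr_gt0 ?mulr_gt0//.
    rewrite mulfV ?gt_eqF ?mulr_gt0//.
    have -> : `|Z c 0 i - Z c' 0 i| * N%:R / (2 * e) = `|u (Z c) i - u (Z c') i|.
      rewrite /u -mulrBr -mulrBl normrM (gtr0_norm N0) normrM normfV.
      rewrite (gtr0_norm (_ : 0 < 2 * e)) ?mulr_gt0// mulrCA mulrA.
      by congr (`|_| * _ / _); ring.
    by rewrite ler_norml; apply/andP; split; lra.
  have := gC _ _ cz cz' _ zz' a; apply/negP; rewrite -ltNge gz gz' /p.
  rewrite -mulrBr -mulrBl !normrM (gtr0_norm eta0) normfV (gtr0_norm M0).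
  have sep : 1 <= `|(c a)%:R - (c' a)%:R| :> R.
    have [lt|lt|/val_inj E] := ltngtP (c a) (c' a); last by rewrite E eqxx in ca.
      by rewrite distrC -natrB 1?ltnW// ger0_norm// ler1n subn_gt0.
    by rewrite -natrB 1?ltnW// ger0_norm// ler1n subn_gt0.
  apply: lt_le_trans (_ : eta * (1 / M%:R) <= _).
    have -> : C * (2 * e / N%:R) = eta * (K / N%:R).
      by rewrite /K; field; rewrite !gt_eqF.
    by rewrite ltr_pM2l// ltr_pdivrMr// mul1r mulrC ltr_pdivlMr.
  by rewrite ler_pM2l// ler_pM2r ?invr_gt0.
move=> /leq_card; rewrite !card_ffun !card_ord NE expnMn expnS leqNgt.
by rewrite /M ltn_mul2r ltnS leqnn expn_gt0.
Qed.

End Cubes.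

(** * Bump functions *)

Section Bump.
Variables (R : realType) (d : nat).
Implicit Types (q z : 'rV[R]_d) (e t : R) (i j : 'I_d).

(** Composing [flat 1] with itself gives a smooth function with a plateau: the
    inner function is constant for t <= 0, and for t >= 1 it makes the argument of
    the outer one nonpositive. *)
Definition step t : R := expR 1 * flat 1 (1 - expR 1 * flat 1 t).

Lemma step_le0 t : t <= 0 -> step t = 1.
Proof.
move=> t0; rewrite /step (flat_le0 _ t0) mulr0 subr0 flat_gt0// hornerC mul1r.
by rewrite invr1 expRN mulfV// gt_eqF// expR_gt0.
Qed.

Lemma step_ge1 t : 1 <= t -> step t = 0.
Proof.
move=> t1; have t0 : 0 < t by rewrite (lt_le_trans _ t1).
rewrite /step [X in _ * X]flat_le0 ?mulr0// subr_le0 flat_gt0// hornerC mul1r.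
by rewrite -expRD -[leLHS]expR0 ler_expR subr_ge0 invf_le1.
Qed.

(** With u = |z_i - q_i| / e, the step u^2 - 4 is nonpositive for u <= 2 and at
    least 1 for u >= 3; so the bump is 1 on the cube of radius 2e, a neighbourhood
    of [cube q e], and 0 outside the cube of radius 3e. *)
Definition cube_bump q e z : R := \prod_i step (((z 0 i - q 0 i) / e) ^+ 2 - 4).

Lemma smooth_cube_bump q e : smooth (cube_bump q e).
Proof.
apply: smooth_prod => i; set u := fun z : 'rV[R]_d => (z 0 i - q 0 i) / e.
have su : smooth u.
  apply: (smoothM (f := fun z => z 0 i - q 0 i) (g := cst e^-1)); last exact: smooth_cst.
  apply: (smoothD (f := fun z => z 0 i) (g := cst (- q 0 i))); last exact: smooth_cst.
  exact: smooth_coord.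
have sv : smooth (fun z => u z ^+ 2 - 4).
  exact: (smoothD (smoothM su su) (smooth_cst (-4))).
have saff c (b : R) f : smooth f -> smooth (fun z : 'rV[R]_d => c * f z + b).
  by move=> sf; exact: (smoothD (smoothZ c sf) (smooth_cst b)).
have -> : (fun z => step (u z ^+ 2 - 4)) = (fun z => expR 1 *
    flat 1 (- expR 1 * flat 1 (u z ^+ 2 - 4) + 1) + 0).
  by apply/funext => z; rewrite addr0 /step mulNr (addrC 1).
apply: (saff); apply: (smooth_flat 1 (f := fun z => - expR 1 * flat 1 (u z ^+ 2 - 4) + 1)).
by apply: (saff); exact: (smooth_flat 1 sv).
Qed.

Lemma bump1 q e z : 0 < e -> (forall i, `|z 0 i - q 0 i| <= 2 * e) -> cube_bump q e z = 1.
Proof.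
move=> e0 zq; have e_ge0 := ltW e0; rewrite /cube_bump big1// => i _; apply: step_le0.
rewrite subr_le0 -real_normK ?num_real// normrM normfV (gtr0_norm e0).
have -> : 4 = 2 ^+ 2 :> R by ring.
by rewrite lerXn2r ?nnegrE ?divr_ge0// ler_pdivrMr.
Qed.

Lemma bump0 q e z i : 0 < e -> 3 * e <= `|z 0 i - q 0 i| -> cube_bump q e z = 0.
Proof.
move=> e0 zq; have e_ge0 := ltW e0; rewrite /cube_bump (bigD1 i)//= step_ge1 ?mul0r//.
rewrite lerBrDr -real_normK ?num_real// normrM normfV (gtr0_norm e0).
apply: le_trans (_ : 3 ^+ 2 <= _); first lra.
by rewrite lerXn2r ?nnegrE ?divr_ge0// ler_pdivlMr.
Qed.

(** Near [cube q e] this is the j-th coordinate, whose gradient is a unit vector. *)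
Definition bump_coord q e j z : R := cube_bump q e z * z 0 j.

Lemma smooth_bump_coord q e j : smooth (bump_coord q e j).
Proof.
exact: smoothM (smooth_cube_bump q e) (smooth_coord R 0 j).
Qed.

Lemma partial_bump_coord q e i j z : 0 < e -> cube q e z ->
  partial (ord0, i) (bump_coord q e j) z = (i == j)%:R.
Proof.
move=> e0 zq.
rewrite -[LHS]/(partials [:: (ord0, i)] (bump_coord q e j) z).
rewrite (@partials_local _ _ _ (ball q (2 * e)) _ (fun z => z 0 j)).
- have dj := is_derive_coord 0 j z (delta_mx ord0 i).
  by rewrite /= /partial derive_val mxE/= eq_sym.
- by apply: ball_open; rewrite mulr_gt0.
- move=> w [_ qw]; rewrite /bump_coord bump1 ?mul1r// => l.
  by rewrite distrC ltW//; exact: qw.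
- split=> [|a l]; first by rewrite mulr_gt0.
  by rewrite (ord1 a) /ball/= distrC (le_lt_trans (zq l))// ltr_pMl// ltr1n.
Qed.

Lemma partials_bump_coord0 q e j s z i : 0 < e -> 3 * e < `|z 0 i - q 0 i| ->
  partials s (bump_coord q e j) z = 0.
Proof.
move=> e0 zq.
rewrite (@partials_local _ _ _ [set z | 3 * e < `|z 0 i - q 0 i|] _ (cst 0)) //=.
- suff -> : partials s (cst 0) = cst 0 :> ('rV[R]_d -> R) by [].
  by elim: s => //= a s ->; apply/funext => w; rewrite /partial derive_cst.
- apply: (@open_comp _ _ (fun w : 'rV[R]_d => `|w 0 i - q 0 i|) [set x | 3 * e < x]).
    have cu := smooth_continuous (smoothD (@smooth_coord R 1 d 0 i) (smooth_cst (- q 0 i))).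
    have cn : continuous (fun w : 'rV[R]_d => `|w 0 i - q 0 i|).
      by move=> w; exact: (cvg_norm (cu w)).
    by move=> w _; exact: cn.
  exact: open_gt.
- by move=> w /= /ltW/(bump0 e0); rewrite /bump_coord => ->; exact: mul0r.
Qed.

End Bump.

(** * Linear functionals of the first derivatives *)

Section Probes.
Variables (R : realType) (d : nat).
Implicit Types (f g : 'rV[R]_d -> R) (q z : 'rV[R]_d) (e : R) (pi : 'I_d -> 'I_d).

Definition pull pi z : 'rV[R]_d := \row_i z 0 (pi i).

(** A term [(w, i, pi)] stands for the functional that sends [f] to [w] times the
    [i]-th partial derivative of [f] at the point obtained from [z] by the index map
    [pi]. Reading off the derivative at (x, x) or (y, x) from z = (x, y) is of this
    kind, and the maps of points so obtained do not increase the sup distance. *)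
Definition probe : Type := seq (R * 'I_d * ('I_d -> 'I_d)).
Implicit Types L : probe.

Definition probe_val L f z : R :=
  \sum_(t <- L) t.1.1 * partial (ord0, t.1.2) f (pull t.2 z).

(** The d partial derivatives of [f] followed by the value of the probe: d + 1
    functions of d variables, whose common zeros are to be avoided. *)
Definition test_map L f z (a : 'I_d.+1) : R :=
  if unlift ord_max a is Some i then partial (ord0, i) f z else probe_val L f z.

Lemma test_map_eq0 L f z :
  (forall a, test_map L f z a = 0) <-> critical_point f z /\ probe_val L f z = 0.
Proof.
split=> [h|[h1 h2] a]; last by rewrite /test_map; case: unliftP.
split; last by have := h ord_max; rewrite /test_map unlift_none.
by move=> [i j]; have := h (lift ord_max j); rewrite /test_map liftK (ord1 i).
Qed.

Lemma cube_pull pi q e z : cube q e z -> cube (pull pi q) e (pull pi z).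
Proof. by move=> zq i; rewrite !mxE; exact: zq. Qed.

Lemma continuous_pull pi : continuous (pull pi).
Proof.
move=> z A /nbhs_ballP[eps eps0 zA]; apply/nbhs_ballP; exists eps => // w [_ zw].
by apply: zA; split=> // i j; rewrite !mxE; exact: zw.
Qed.

Lemma probe_val_lin L f N (p : 'I_N -> R) (psi : 'I_N -> 'rV[R]_d -> R) z :
  smooth f -> (forall j, smooth (psi j)) ->
  probe_val L (f + \sum_j p j *: psi j) z =
  probe_val L f z + \sum_j p j * probe_val L (psi j) z.
Proof.
move=> sf spsi; have ss := smooth_sum p spsi.
under [in RHS]eq_bigr do rewrite mulr_sumr.
rewrite exchange_big -big_split/=; apply: eq_bigr => t _.
rewrite -[partial _ (f + _)]/(partials [:: _] (f + _)) partialsD// partials_sum//=.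
rewrite fctE fct_sumE mulrDr mulr_sumr; congr (_ + _).
by apply: eq_bigr => j _; rewrite mulrCA.
Qed.

Lemma test_map_lin L f N (p : 'I_N -> R) (psi : 'I_N -> 'rV[R]_d -> R) z a :
  smooth f -> (forall j, smooth (psi j)) ->
  test_map L (f + \sum_j p j *: psi j) z a =
  test_map L f z a + \sum_j p j * test_map L (psi j) z a.
Proof.
move=> sf spsi; rewrite /test_map; case: unliftP => [i _|_]; last first.
  exact: probe_val_lin.
rewrite -[partial _ (f + _)]/(partials [:: _] (f + _)) partialsD//; last exact: smooth_sum.
by rewrite partials_sum//= fctE fct_sumE.
Qed.

Lemma continuous_test_map L f a : smooth f -> continuous (fun z => test_map L f z a).
Proof.
move=> sf; have cp i := smooth_continuous (smooth_partial (ord0, i) sf).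
rewrite /test_map; case: unliftP => [i _|_]; first exact: cp.
apply: continuous_big => [|t _ z]; first exact: add_continuous.
have cq : continuous (partial (ord0, t.1.2) f \o pull t.2).
  by move=> w; apply: continuous_comp; [exact: continuous_pull|exact: cp].
exact: (continuousM (@cst_continuous _ _ t.1.1 z) (cq z)).
Qed.

Lemma lipschitz_test_map L f q e : smooth f -> exists2 C, 0 <= C &
  forall z z', cube q e z -> cube q e z' ->
  forall t, (forall i, `|z 0 i - z' 0 i| <= t) ->
  forall a, `|test_map L f z a - test_map L f z' a| <= C * t.
Proof.
move=> sf.
suff /choice[C CP] a : exists C, 0 <= C /\
    forall z z', cube q e z -> cube q e z' ->
    forall t, (forall i, `|z 0 i - z' 0 i| <= t) ->
    `|test_map L f z a - test_map L f z' a| <= C * t.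
  exists (\sum_a C a); first by apply: sumr_ge0 => a _; have [] := CP a.
  move=> z z' cz cz' t zz' a; have [Ca CPa] := CP a.
  apply: le_trans (CPa _ _ cz cz' _ zz') _; rewrite mulr_suml (bigD1 a)//= lerDl.
  apply: sumr_ge0 => b _; have [Cb CPb] := CP b.
  by apply: le_trans (CPb _ _ cz cz' _ zz').
have lipp i q' := smooth_lipschitz q' e (smooth_partial (ord0, i) sf).
rewrite /test_map; case: unliftP => [i _|_].
  by have [C C0 CP] := lipp i q; exists C.
rewrite /probe_val; elim: L => [|t L [C [C0 CP]]].
  exists 0; split=> // z z' _ _ t _.
  by rewrite !big_nil subrr normr0 mul0r.
have [D D0 DP] := lipp t.1.2 (pull t.2 q).
exists (`|t.1.1| * D + C); split=> [|z z' cz cz' u zz'].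
  by rewrite addr_ge0// mulr_ge0.
rewrite !big_cons opprD addrACA mulrDl (le_trans (ler_normD _ _))//.
apply: lerD; last exact: (CP _ _ cz cz' _ zz').
rewrite -mulrBr normrM -mulrA ler_wpM2l//; apply: DP; [exact: cube_pull..|].
by move=> i; rewrite !mxE.
Qed.

Lemma test_map_close L f g z (delta : R) : 0 <= delta ->
  (forall i w, `|partial (ord0, i) g w - partial (ord0, i) f w| <= delta) ->
  forall a, `|test_map L g z a - test_map L f z a| <=
    (1 + \sum_(t <- L) `|t.1.1|) * delta.
Proof.
move=> delta0 gf a; rewrite mulrDl mul1r /test_map; case: unliftP => [i _|_].
  by rewrite (le_trans (gf i z))// lerDl mulr_ge0 ?sumr_ge0.
rewrite ler_wpDl// -sumrB mulr_suml.
rewrite (le_trans (ler_norm_sum _ _ _))//; apply: ler_sum => t _.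
by rewrite -mulrBr normrM ler_wpM2l.
Qed.

End Probes.

(** * Openness and density of avoidance *)

Section Avoidance.
Variables (R : realType) (d : nat) (S : set ('rV[R]_d -> R)).
Implicit Types (L : probe R d) (q z : 'rV[R]_d) (e : R).

Lemma open_whitneyE : open = @whitney_open R 1 d S :> set (set (smooth_space S)).
Proof. by []. Qed.

Definition avoids L q e : set (smooth_space S) :=
  [set phi | forall z, cube q e z -> critical_point phi z -> probe_val L phi z != 0].

Lemma avoidsP L q e phi : avoids L q e phi <->
  forall z, cube q e z -> exists a, test_map L phi z a != 0.
Proof.
split=> [h z zq|h z zq cz]; last first.
  by apply/eqP => Lz; have [a] := h z zq; rewrite (test_map_eq0 L phi z).2 ?eqxx.
apply: contrapT => na; have /test_map_eq0[cz /eqP] : forall a, test_map L phi z a = 0.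
  by move=> a; apply/eqP/negPn/negP => za; apply: na; exists a.
exact/negP/h.
Qed.

(** On the compact cube the l^1 norm of the test map has a positive minimum, which
    survives a C^1-small change of [phi]; a constant [delta] is enough. *)
Lemma open_avoids L q e : 0 <= e -> open (avoids L q e).
Proof.
move=> e0; rewrite open_whitneyE => phi /avoidsP av.
pose h z := \sum_a `|test_map L phi z a|.
have ch : continuous h.
  apply: continuous_big => [|a _ z]; first exact: add_continuous.
  exact: (cvg_norm (@continuous_test_map _ _ L phi a (smooth_funP phi) z)).
have [c cq cmin] := compact_EVT_min (ex_intro _ q (cube_center q e0))
  (@cube_compact _ _ q e) (continuous_subspaceT ch).
have hc : 0 < h c.
  have [|a a0] := av c; first by rewrite inE in cq.
  rewrite /h (bigD1 a)//= ltr_pwDl ?normr_gt0 ?sumr_ge0//.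
pose K := (d.+1)%:R * (1 + \sum_(t <- L) `|t.1.1|).
have K0 : 0 <= K by rewrite mulr_ge0// addr_ge0// sumr_ge0.
pose delta := h c / (K + 1).
have delta0 : 0 < delta by rewrite divr_gt0// ltr_wpDl.
exists 1%N, (cst delta); split=> //; first exact: cst_continuous.
move=> psi psiphi; apply/avoidsP => z zq; apply: contrapT => na.
have psi0 a : test_map L psi z a = 0.
  by apply/eqP/negPn/negP => za; apply: na; exists a.
have := cmin z (mem_set zq); apply/negP; rewrite -ltNge.
have close i w : `|partial (ord0, i) psi w - partial (ord0, i) phi w| <= delta.
  exact/ltW/(psiphi [:: (ord0, i)]).
apply: le_lt_trans (_ : K * delta < _); last first.
  by rewrite /delta mulrA ltr_pdivrMr ?ltr_wpDl// mulrDr mulr1 mulrC ltrDl.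
rewrite /K -mulrA -[d.+1 in leRHS]card_ord mulr_natl -sumr_const; apply: ler_sum => a _.
by have := test_map_close L z (ltW delta0) close a; rewrite psi0 sub0r normrN.
Qed.

(** A compactly supported perturbation can be scaled into any Whitney
    neighbourhood, because its finitely many partial derivatives up to order [r]
    have a common bound. *)
Lemma support_bounded (f : 'rV[R]_d -> R) q e : smooth f ->
  (forall s z, ~ cube q e z -> partials s f z = 0) ->
  forall r, exists2 M, 0 <= M & forall s, (size s <= r)%N ->
    forall z, `|partials s f z| <= M.
Proof.
move=> sf f0 r; elim: r f sf f0 => [|r IHr] f sf f0.
  have [M M0 MP] := cube_bounded q e (smooth_continuous sf).
  exists M => // -[|//] _ z; have [/MP//|/(f0 [::])/= ->] := pselect (cube q e z).
  by rewrite normr0.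
have /choice[N NP] ij : exists N, 0 <= N /\ forall s, (size s <= r)%N ->
    forall z, `|partials s (partial ij f) z| <= N.
  have [||N N0 NP] := IHr (partial ij f); [exact: smooth_partial| |by exists N].
  by move=> s z /f0; rewrite partials_partial; exact.
have [M M0 MP] := IHr f sf f0.
exists (M + \sum_ij N ij) => [|s].
  by rewrite addr_ge0// sumr_ge0// => ij _; have [] := NP ij.
have S0 : 0 <= \sum_ij N ij by rewrite sumr_ge0// => ij _; have [] := NP ij.
case/lastP: s => [_ z|s ij]; first by rewrite (le_trans (MP [::] _ z))// lerDl.
rewrite size_rcons ltnS -partials_partial => sr z; have [_ /(_ s sr z) NPij] := NP ij.
rewrite ler_wpDl// (le_trans NPij)// (bigD1 ij)//= lerDl sumr_ge0// => kl _.
by have [] := NP kl.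
Qed.

(** By linearity, the test map of [phi + \sum_j p j *: psi j] on the cube is that of
    [phi] plus the vector with entries [kappa j * p j]. It vanishes at [z] only if
    [p] is the value at [z] of a fixed Lipschitz map [g], and small [p] outside the
    image of [g] exist because the cube has dimension d and [p] has d + 1
    entries. *)
Lemma dense_avoids L q e (psi : 'I_d.+1 -> 'rV[R]_d -> R) q' e'
    (kappa : 'I_d.+1 -> R) :
  0 < e -> 0 <= e' ->
  (forall phi p, S phi -> S (phi + \sum_j p j *: psi j)) ->
  (forall j, smooth (psi j)) ->
  (forall j s z, ~ cube q' e' z -> partials s (psi j) z = 0) ->
  (forall a, kappa a != 0) ->
  (forall a j z, cube q e z -> test_map L (psi j) z a = kappa j * (a == j)%:R) ->
  dense (avoids L q e).
Proof.
rewrite /dense open_whitneyE.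
move=> e0 e'0 Spsi spsi psi0 kappa0 psiE O [phi Ophi] /(_ phi Ophi)[r [delta [cd d0 dO]]].
have sphi := smooth_funP phi.
have [c cq cmin] := compact_EVT_min (ex_intro _ q' (cube_center q' e'0))
  (@cube_compact _ _ q' e') (continuous_subspaceT cd).
have /choice[M MP] j : exists M, 0 <= M /\ forall s, (size s <= r)%N ->
    forall z, `|partials s (psi j) z| <= M.
  by have [M] := support_bounded (spsi j) (psi0 j) r; exists M.
have S0 : 0 <= \sum_j M j by rewrite sumr_ge0// => j _; have [] := MP j.
pose eta := delta c / (\sum_j M j + 1).
have eta0 : 0 < eta by rewrite divr_gt0// ltr_wpDl.
pose g z a := - test_map L phi z a / kappa a.
have [C C0 CP] := lipschitz_test_map L q e sphi.
pose W := \sum_a `|(kappa a)^-1|.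
have W0 : 0 <= W by rewrite sumr_ge0.
have [|z z' cz cz' t zz' a|p peta pmiss] :=
  @lipschitz_image_misses _ _ g q e (C * W) eta e0 _ eta0; first exact: mulr_ge0.
  rewrite /g -mulrBl -opprD mulNr normrN normrM mulrAC.
  rewrite ler_pM// ?CP//.
  by rewrite /W (bigD1 a)//= lerDl sumr_ge0.
have sphi' := smoothD sphi (smooth_sum p spsi).
pose phi' := SmoothSpace sphi' (Spsi phi p (smooth_fun_in phi)).
exists phi'; split.
- apply: dO => s sr z /=.
  rewrite partialsD//; last exact: smooth_sum.
  rewrite partials_sum// fctE addrAC subrr add0r fct_sumE.
  have [zq'|zq'] := pselect (cube q' e' z); last first.
    by rewrite big1 ?normr0// => j _; rewrite fctE psi0// [LHS]mulr0.
  apply: lt_le_trans (cmin z (mem_set zq')).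
  apply: le_lt_trans (_ : (\sum_j M j) * eta < _); last first.
    by rewrite /eta mulrA ltr_pdivrMr ?ltr_wpDl// mulrDr mulr1 mulrC ltrDl.
  rewrite (le_trans (ler_norm_sum _ _ _))// mulr_suml; apply: ler_sum => j _.
  rewrite [`|_|]normrM mulrC; have [M0 MPj] := MP j.
  have /andP[p0 pe] := peta j.
  by rewrite ler_pM// ?MPj// ger0_norm.
- apply/avoidsP => z zq; have [a ga] := pmiss z zq.
  exists a; apply: contraNN ga; rewrite /= test_map_lin//.
  rewrite (bigD1 a)//= psiE// eqxx mulr1 big1 ?addr0; last first.
    by move=> j ja; rewrite psiE// eq_sym (negPf ja) !mulr0.
  by rewrite addr_eq0 => /eqP E; rewrite /g E opprK mulfK.
Qed.

End Avoidance.

(** * The perturbations of a coupling function *)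

Section Perturbation.
Variables (R : realType) (k : nat).
Local Notation d := (k + k)%N.
Implicit Types (q z w : 'rV[R]_d) (e : R) (i j : 'I_d) (sigma sym : bool).

(** The index maps of (x, y) |-> (y, x), and of (x, y) |-> (x, x) or (y, y). *)
Definition swap_idx i : 'I_d :=
  match fintype.split i with inl l => rshift k l | inr l => lshift k l end.

Definition diag_idx sigma i : 'I_d :=
  match fintype.split i with inl l | inr l => if sigma then lshift k l else rshift k l end.

Lemma swap_lshift (l : 'I_k) : swap_idx (lshift k l) = rshift k l.
Proof. by rewrite /swap_idx (unsplitK (inl l)). Qed.

Lemma swap_rshift (l : 'I_k) : swap_idx (rshift k l) = lshift k l.
Proof. by rewrite /swap_idx (unsplitK (inr l)). Qed.

Lemma diag_lshift sigma (l : 'I_k) :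
  diag_idx sigma (lshift k l) = if sigma then lshift k l else rshift k l.
Proof. by rewrite /diag_idx (unsplitK (inl l)). Qed.

Lemma diag_rshift sigma (l : 'I_k) :
  diag_idx sigma (rshift k l) = if sigma then lshift k l else rshift k l.
Proof. by rewrite /diag_idx (unsplitK (inr l)). Qed.

Lemma swap_idxK : involutive swap_idx.
Proof.
by move=> i; case: (split_ordP i) => l ->;
  rewrite ?(swap_lshift, swap_rshift).
Qed.

Lemma diag_swap sigma i : diag_idx sigma (swap_idx i) = diag_idx sigma i.
Proof.
case: (split_ordP i) => l ->.
  by rewrite swap_lshift diag_lshift diag_rshift.
by rewrite swap_rshift diag_lshift diag_rshift.
Qed.

Lemma pull_swap (x y : 'rV[R]_k) : pull swap_idx (row_mx x y) = row_mx y x.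
Proof.
apply/rowP => i; rewrite mxE; case: (split_ordP i) => l ->.
  by rewrite swap_lshift row_mxEr row_mxEl.
by rewrite swap_rshift row_mxEr row_mxEl.
Qed.

Lemma pull_diag sigma (x y : 'rV[R]_k) :
  pull (diag_idx sigma) (row_mx x y) = if sigma then row_mx x x else row_mx y y.
Proof.
apply/rowP => i; rewrite mxE; case: (split_ordP i) => l ->.
  by rewrite diag_lshift; case: sigma; rewrite ?(row_mxEl, row_mxEr).
by rewrite diag_rshift; case: sigma; rewrite ?(row_mxEl, row_mxEr).
Qed.

Lemma bump_coord_swap q e j z :
  bump_coord q e j (pull swap_idx z) = bump_coord (pull swap_idx q) e (swap_idx j) z.
Proof.
rewrite /bump_coord /cube_bump mxE (reindex_inj (can_inj swap_idxK))/=; congr (_ * _).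
by apply: eq_bigr => i _; rewrite !mxE swap_idxK.
Qed.

(** The [j0]-th coordinate of the gradient at a vertex with value [u], where [u] is
    x if [sigma] holds and y otherwise, and (x, y) is critical. The swapped term
    has the derivative with respect to the argument of [phi(y, x)] that equals
    [u]. *)
Definition vertex_probe (j0 : 'I_k) sigma (a b c : nat) : probe R d :=
  [:: (a%:R, lshift k j0, diag_idx sigma); (b%:R, rshift k j0, diag_idx sigma);
      (c%:R, if sigma then rshift k j0 else lshift k j0, swap_idx)].

(** For [sym = true] the mirror image of the cut-off coordinate is added, which
    makes the function invariant under exchange of x and y. *)
Definition sym_bump sym q e j : 'rV[R]_d -> R :=
  bump_coord q e j + sym%:R *: bump_coord (pull swap_idx q) e (swap_idx j).

Lemma smooth_sym_bump sym q e j : smooth (sym_bump sym q e j).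
Proof. by apply: smoothD; [|apply: smoothZ]; exact: smooth_bump_coord. Qed.

Lemma partials_sym_bump sym q e j s z :
  partials s (sym_bump sym q e j) z = partials s (bump_coord q e j) z +
    sym%:R * partials s (bump_coord (pull swap_idx q) e (swap_idx j)) z.
Proof.
rewrite partialsD ?partialsZ//; try exact: smooth_bump_coord.
exact/smoothZ/smooth_bump_coord.
Qed.

Lemma sym_bump_invariant q e j x y :
  sym_bump true q e j (row_mx x y) = sym_bump true q e j (row_mx y x).
Proof.
rewrite -[row_mx y x]pull_swap /sym_bump !fctE !bump_coord_swap swap_idxK.
have -> : pull swap_idx (pull swap_idx q) = q.
  by apply/rowP => i; rewrite !mxE swap_idxK.
by rewrite /GRing.scale/= !mul1r addrC.
Qed.

(** The first d functions control the gradient near [q]. The last one lives near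
    the diagonal point (u, u) and controls the value of the probe. *)
Definition perturbation (j0 : 'I_k) sigma sym q e (a : 'I_d.+1) : 'rV[R]_d -> R :=
  if unlift ord_max a is Some i then sym_bump sym q e i
  else sym_bump sym (pull (diag_idx sigma) q) e (lshift k j0).

Lemma smooth_perturbation (j0 : 'I_k) sigma sym q e a :
  smooth (perturbation j0 sigma sym q e a).
Proof. by rewrite /perturbation; case: unlift => [i|]; exact: smooth_sym_bump. Qed.

Lemma perturbation_support (j0 : 'I_k) sigma sym q e a s z : 0 < e ->
  ~ cube 0 (\sum_i `|q 0 i| + 4 * e) z ->
  partials s (perturbation j0 sigma sym q e a) z = 0.
Proof.
move=> e0 /existsNP[i] /negP; rewrite -ltNge mxE subr0 => zi.
have far (pi : 'I_d -> 'I_d) : 3 * e < `|z 0 i - pull pi q 0 i|.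
  apply: lt_le_trans (lerB_dist _ _); rewrite ltrBrDr (le_lt_trans _ zi)//.
  rewrite addrC mxE; apply: lerD; last lra.
  by rewrite (bigD1 (pi i))//= lerDl sumr_ge0.
have far_q : 3 * e < `|z 0 i - q 0 i|.
  by have := far id; rewrite mxE.
have far2 (pi pi' : 'I_d -> 'I_d) : 3 * e < `|z 0 i - pull pi (pull pi' q) 0 i|.
  by have := far (pi' \o pi); rewrite !mxE.
rewrite /perturbation; case: unlift => [l|]; rewrite partials_sym_bump;
  by rewrite !(@partials_bump_coord0 _ _ _ _ _ _ _ i)// mulr0 addr0.
Qed.

(** In [cube q e] the points z, (u, u) and (y, x) keep a distance greater than 3e
    from each other's centres, thanks to the gap of 10e between the two blocks of
    [q], so a bump placed around one of them is not seen at the others. The one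
    exception is the mirror image of a bump around [q], which is seen at (y, x);
    hence the condition that [c = 0] when symmetrizing. *)
Lemma test_map_perturbation (j0 jj : 'I_k) sigma sym (a b c : nat) q e z
    (i j : 'I_d.+1) :
  0 < e -> 10 * e <= `|q 0 (lshift k jj) - q 0 (rshift k jj)| ->
  (sym -> c = 0%N) -> cube q e z ->
  test_map (vertex_probe j0 sigma a b c) (perturbation j0 sigma sym q e j) z i =
  (if j == ord_max then (a + sym * b)%:R else 1) * (i == j)%:R.
Proof.
move=> e0 gap symc zq.
(* [u] indexes the block copied by the diagonal map, [o] the other block; the two
   differ at [q], and one of these two indices separates any given pair. *)
pose o := if sigma then rshift k jj else lshift k jj.
pose u := if sigma then lshift k jj else rshift k jj.
have swap_u : swap_idx u = o.
  by rewrite /u /o; case: (sigma); rewrite (swap_lshift, swap_rshift).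
have swap_o : swap_idx o = u by rewrite -swap_u swap_idxK.
have diag_o : diag_idx sigma o = u.
  by rewrite /u /o; case: (sigma); rewrite (diag_lshift, diag_rshift).
have diag_u : diag_idx sigma u = u by rewrite -{1}swap_o diag_swap diag_o.
have gap_uo : 10 * e <= `|q 0 u - q 0 o|.
  by rewrite /u /o; case: (sigma); rewrite // distrC.
have far_uo : 3 * e < `|z 0 u - q 0 o|.
  have := ler_distD (z 0 u) (q 0 u) (q 0 o); have := zq u;
  rewrite (distrC (z 0 u) (q 0 u)); lra.
have far_ou : 3 * e < `|z 0 o - q 0 u|.
  have := ler_distD (z 0 o) (q 0 o) (q 0 u); have := zq o.
  rewrite (distrC (q 0 o) (q 0 u)) (distrC (z 0 o) (q 0 o)); lra.
have diag_swap_q : pull swap_idx (pull (diag_idx sigma) q) = pull (diag_idx sigma) q.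
  by apply/rowP => l; rewrite !mxE diag_swap.
have partial_sym l l' (w c' : 'rV[R]_d) : partial (ord0, l) (sym_bump sym c' e l') w =
    partial (ord0, l) (bump_coord c' e l') w +
    sym%:R * partial (ord0, l) (bump_coord (pull swap_idx c') e (swap_idx l')) w.
  exact: (partials_sym_bump sym c' e l' [:: (ord0, l)] w).
have bump_far l l' (w c' : 'rV[R]_d) x : 3 * e < `|w 0 x - c' 0 x| ->
    partial (ord0, l) (bump_coord c' e l') w = 0.
  exact: (@partials_bump_coord0 _ _ c' e l' [:: (ord0, l)] w x).
rewrite /test_map /perturbation.
case: (unliftP ord_max i) => [i' ->|->]; case: (unliftP ord_max j) => [j' ->|->];
  rewrite ?eqxx ?(inj_eq lift_inj) ?[lift _ _ == _]eq_sym
  ?(negPf (neq_lift _ _)) ?mul1r ?mulr0 ?mulr1.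
- rewrite partial_sym partial_bump_coord// (@bump_far _ _ _ _ u) ?mulr0 ?addr0//.
  by rewrite mxE swap_u.
- rewrite partial_sym diag_swap_q !(@bump_far _ _ _ _ o) ?mulr0 ?addr0//;
  by rewrite mxE diag_o.
- rewrite /probe_val /vertex_probe !big_cons big_nil/= !partial_sym.
  do 2!rewrite (@bump_far _ _ (pull (diag_idx sigma) z) q o) ?mxE ?diag_o//.
  do 2!rewrite (@bump_far _ _ (pull (diag_idx sigma) z) (pull swap_idx q) u)
    ?mxE ?diag_u ?swap_u//.
  rewrite (@bump_far _ _ (pull swap_idx z) q u) ?mxE ?swap_u//.
  have [->|->] : c = 0%N \/ sym = false.
    by case: (sym) symc => [/(_ isT)|_]; [left|right].
  - by rewrite !(mulr0, mul0r, addr0).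
  - by rewrite !(mulr0, mul0r, addr0).
- rewrite /probe_val /vertex_probe !big_cons big_nil/= !partial_sym diag_swap_q.
  have zq' := cube_pull (diag_idx sigma) zq.
  rewrite !(@bump_far _ _ (pull swap_idx z) _ u) ?mxE ?swap_u ?diag_u//.
  rewrite !partial_bump_coord// swap_lshift !eqxx.
  have lr : (lshift k j0 == rshift k j0) = false by rewrite eq_lrshift.
  have rl : (rshift k j0 == lshift k j0) = false by rewrite eq_rlshift.
  by rewrite lr rl !(mulr0, addr0, add0r, mulr1) natrD natrM mulrC.
Qed.

End Perturbation.

(** * Genericity *)

Lemma residual_countable (J : countType) (T : topologicalType) (F : J -> set T) :
  (forall i, open (F i) /\ dense (F i)) -> residual (\bigcap_i F i).
Proof.
move=> oF; exists (fun m => if unpickle m is Some i then F i else setT).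
  move=> m; case: unpickle => [i|]; first exact: oF.
  split; [exact: openT|by move=> O [x Ox] _; exists x].
by move=> x Fx i _; have := Fx (pickle i) I; rewrite pickleK.
Qed.

Section Genericity.
Variables (R : realType) (k : nat) (S : set ('rV[R]_(k + k) -> R)) (j0 : 'I_k).
Hypothesis hS : S = setT \/ S = Z2_invariant (R := R) (k := k).
Local Notation d := (k + k)%N.

Lemma dense_vertex_avoids sigma (a b c : nat) (q : 'rV[R]_d) (e : R) (jj : 'I_k) :
  (0 < a)%N -> (S = setT \/ c = 0%N) -> 0 < e ->
  10 * e <= `|q 0 (lshift k jj) - q 0 (rshift k jj)| ->
  dense (avoids (S := S) (vertex_probe R j0 sigma a b c) q e).
Proof.
move=> a0 Sc e0 gap.
have [sym [symc symS]] : exists sym : bool, (sym -> c = 0%N) /\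
    forall phi (p : 'I_d.+1 -> R), S phi ->
      S (phi + \sum_j p j *: perturbation j0 sigma sym q e j).
  case: hS Sc => [-> _|-> [SZ|c0]]; first by exists false.
    by exists false; split=> //; rewrite SZ.
  exists true; split=> // phi p phiZ x y.
  rewrite !fctE phiZ !fct_sumE; congr (_ + _); apply: eq_bigr => j _.
  rewrite !fctE /perturbation; case: unlift => [i|]; by rewrite sym_bump_invariant.
pose kappa (j : 'I_d.+1) : R := if j == ord_max then (a + sym * b)%:R else 1.
apply: (@dense_avoids _ _ _ _ _ _ (perturbation j0 sigma sym q e)
  0 (\sum_i `|q 0 i| + 4 * e) kappa) => //.
- by rewrite addr_ge0 ?sumr_ge0// mulr_ge0// ltW.
- by move=> j; exact: smooth_perturbation.
- by move=> j s z; exact: perturbation_support.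
- move=> j; rewrite /kappa; case: ifP => _; last exact: oner_neq0.
  by rewrite pnatr_eq0 -lt0n addn_gt0 a0.
- by move=> i j z zq; rewrite (test_map_perturbation _ _ _ _ _ _ e0 gap symc zq).
Qed.

(** If the gap between x and y is at least 12e, a centre within e of (x, y) still
    has a gap of at least 10e. *)
Lemma rational_cube (x y : 'rV[R]_k) : x <> y ->
  exists (q : 'rV[rat]_d) (m : nat) (jj : 'I_k),
    let q' := map_mx ratr q : 'rV[R]_d in
    cube q' m.+1%:R^-1 (row_mx x y) /\
    10 * m.+1%:R^-1 <= `|q' 0 (lshift k jj) - q' 0 (rshift k jj)|.
Proof.
move=> xy; have [jj xyj] : exists jj, x 0 jj != y 0 jj.
  apply: contrapT => nj; apply: xy; apply/rowP => l; apply/eqP/negPn/negP => xyl.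
  by apply: nj; exists l.
have gap0 : 0 < `|x 0 jj - y 0 jj| by rewrite normr_gt0 subr_eq0.
pose m := Num.truncn (12 / `|x 0 jj - y 0 jj|); pose e : R := m.+1%:R^-1.
have e0 : 0 < e by rewrite invr_gt0.
have gap : 12 * e <= `|x 0 jj - y 0 jj|.
  rewrite ler_pdivrMr// mulrC -ler_pdivrMr//; exact/ltW/truncnS_gt.
have /choice[q qP] i : exists r : rat, `|row_mx x y 0 i - ratr r| <= e.
  have [|r] := @rat_in_itvoo R (row_mx x y 0 i - e) (row_mx x y 0 i + e).
    by rewrite ltrBlDr -addrA ltrDl addr_gt0.
  rewrite in_itv/= => /andP[r1 r2]; exists r.
  by rewrite ler_norml; apply/andP; split; lra.
have qE i : map_mx ratr (\row_i q i) 0 i = ratr (q i) :> R by rewrite !mxE.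
exists (\row_i q i), m, jj => /=; split; first by move=> i; rewrite qE.
rewrite !qE -/e.
have := qP (lshift k jj); have := qP (rshift k jj); rewrite row_mxEl row_mxEr.
set X := x 0 jj in gap *; set Y := y 0 jj in gap *.
set Q := ratr (q (lshift k jj)); set Q' := ratr (q (rshift k jj)) => h1 h2.
have := ler_distD Q X Y; have := ler_distD Q' Q Y.
rewrite (distrC Q' Y); lra.
Qed.

(** The countable index consists of the probe and of the rational cube; indices
    without a gap, or whose weights are not of the required form, impose no
    condition. *)
Lemma generic_vertex_probe : exists2 U : set (smooth_space S), residual U &
  forall phi : smooth_space S, U phi ->
  forall x0 y0 : 'rV[R]_k, x0 <> y0 -> critical_point phi (row_mx x0 y0) ->
  forall sigma (a b c : nat), (0 < a)%N -> (S = setT \/ c = 0%N) ->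
  probe_val (vertex_probe R j0 sigma a b c) phi (row_mx x0 y0) != 0.
Proof.
pose J : countType := (bool * (nat * nat * nat) * ('rV[rat]_d * nat))%type.
pose L (i : J) : probe R d := vertex_probe R j0 i.1.1 i.1.2.1.1 i.1.2.1.2 i.1.2.2.
pose q (i : J) : 'rV[R]_d := map_mx ratr i.2.1.
pose e (i : J) : R := i.2.2.+1%:R^-1.
pose ok (i : J) := [/\ (0 < i.1.2.1.1)%N, S = setT \/ i.1.2.2 = 0%N &
  exists jj, 10 * e i <= `|q i 0 (lshift k jj) - q i 0 (rshift k jj)|].
pose F (i : J) : set (smooth_space S) :=
  if pselect (ok i) then avoids (L i) (q i) (e i) else setT.
exists (\bigcap_i F i).
  apply: residual_countable => i; rewrite /F; case: pselect => [[a0 Sc [jj gap]]|_] /=.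
    have e0 : 0 < e i by rewrite invr_gt0.
    by split; [exact/open_avoids/ltW|exact: dense_vertex_avoids gap].
  by split; [exact: openT|move=> O [x Ox] _; exists x].
move=> phi Uphi x0 y0 xy cxy sigma a b c a0 Sc.
have [r [m [jj [cube_xy gap]]]] := rational_cube xy.
pose i : J := (sigma, (a, b, c), (r, m)).
have := Uphi i I; rewrite /F; case: pselect => /= [_ av|nok].
  exact: av.
by exfalso; apply: nok; split=> //; exists jj.
Qed.

Lemma Z2_partial (phi : 'rV[R]_d -> R) (i : 'I_d) (z : 'rV[R]_d) :
  Z2_invariant phi -> partial (ord0, swap_idx i) phi (pull (@swap_idx k) z) =
    partial (ord0, i) phi z.
Proof.
move=> phiZ; have phi_swap w : phi (pull (@swap_idx k) w) = phi w.
  by rewrite -[w]hsubmxK pull_swap phiZ.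
suff E : (fun h : R => h^-1 *: ((phi \o shift (pull (@swap_idx k) z))
      (h *: delta_mx ord0 (swap_idx i)) - phi (pull (@swap_idx k) z))) =
    (fun h : R => h^-1 *: ((phi \o shift z) (h *: delta_mx ord0 i) - phi z)).
  by rewrite /partial /derive E.
apply/funext => h /=.
rewrite phi_swap; congr (_ *: (_ - _)); rewrite -[RHS]phi_swap; congr phi.
by apply/rowP => l; rewrite !mxE/= (can2_eq (@swap_idxK k) (@swap_idxK k)).
Qed.

End Genericity.

(** * Coupled sums and bipartitions *)

Section GraphSums.
Variables (R : realType) (n k : nat) (E : {set {set 'I_n}}).
Variables (rho tau : {set 'I_n} -> 'I_n) (phi : 'rV[R]_(k + k) -> R).
Hypothesis cardE : forall e, e \in E -> #|e| = 2%N.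
Hypothesis hrt : edge_endpoints E rho tau.
Hypothesis sphi : smooth phi.
Implicit Types (x : 'M[R]_(n, k)) (v : 'I_n) (j : 'I_k).

Lemma endpoints_neq e : e \in E -> rho e != tau e.
Proof.
by move=> eE; have := cardE eE; rewrite {1}(hrt eE) cards2; case: eqP.
Qed.

(** The endpoints are distinct, so a displacement of the vertex [v] moves at most
    one of the two arguments of [phi]. *)
Lemma is_derive_edge e v j x : e \in E ->
  is_derive x (delta_mx v j)
    (fun x => phi (row_mx (row (rho e) x) (row (tau e) x)))
    ((v == rho e)%:R * partial (ord0, lshift k j) phi
        (row_mx (row (rho e) x) (row (tau e) x)) +
     (v == tau e)%:R * partial (ord0, rshift k j) phi
        (row_mx (row (rho e) x) (row (tau e) x))).
Proof.
move=> eE; set z := row_mx _ _.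
pose w : 'rV[R]_(k + k) := row_mx (row (rho e) (delta_mx v j)) (row (tau e) (delta_mx v j)).
have x0 : x = 0 *: delta_mx v j + x by rewrite scale0r add0r.
have z0 : z = 0 *: w + z by rewrite scale0r add0r.
rewrite [x in is_derive x]x0; apply/is_derive_lineP.
have -> : (fun s : R => phi (row_mx (row (rho e) (s *: delta_mx v j + x))
    (row (tau e) (s *: delta_mx v j + x)))) = (fun s => phi (s *: w + z)).
  apply/funext => s; congr phi.
  by rewrite /w /z scale_row_mx add_row_mx !linearD !linearZ.
set D := (D in is_derive _ _ _ D).
suff : is_derive (0 *: w + z) w phi D by move/is_derive_lineP.
rewrite -z0 {}/D.
have row_delta (u : 'I_n) : row u (delta_mx v j : 'M[R]_(n, k)) =
    (v == u)%:R *: delta_mx ord0 j.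
  apply/rowP => l; rewrite !mxE/= eq_sym.
  by case: eqP; rewrite ?mul1r ?mul0r.
rewrite /w !row_delta; have rt := endpoints_neq eE.
case: (v =P rho e) => [->|_].
  rewrite (negPf rt) scale1r scale0r mul1r mul0r addr0.
  have -> : row_mx (delta_mx ord0 j) 0 = delta_mx ord0 (lshift k j) :> 'rV[R]_(k + k).
    apply/rowP => l; rewrite !mxE; case: (split_ordP l) => m ->.
      by rewrite !mxE (inj_eq (@lshift_inj _ _)).
    by rewrite !mxE eq_rlshift.
  exact: (is_derive_partial (ord0, lshift k j) z sphi).
case: (v =P tau e) => [vt|_]; last first.
  by rewrite !scale0r row_mx0 !mul0r addr0; exact: is_derive0.
rewrite scale1r scale0r mul1r mul0r add0r.
have -> : row_mx 0 (delta_mx ord0 j) = delta_mx ord0 (rshift k j) :> 'rV[R]_(k + k).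
  apply/rowP => l; rewrite !mxE; case: (split_ordP l) => m ->.
    by rewrite !mxE eq_lrshift.
  by rewrite !mxE (inj_eq (@rshift_inj _ _)).
exact: (is_derive_partial (ord0, rshift k j) z sphi).
Qed.

Lemma partial_coupled_sum v j x :
  partial (v, j) (coupled_sum E rho tau phi) x =
  \sum_(e in E) ((v == rho e)%:R * partial (ord0, lshift k j) phi
        (row_mx (row (rho e) x) (row (tau e) x)) +
     (v == tau e)%:R * partial (ord0, rshift k j) phi
        (row_mx (row (rho e) x) (row (tau e) x))).
Proof.
have [_ <-//] : is_derive x (delta_mx v j) (coupled_sum E rho tau phi)
  (\sum_(e in E) ((v == rho e)%:R * partial (ord0, lshift k j) phi
        (row_mx (row (rho e) x) (row (tau e) x)) +
     (v == tau e)%:R * partial (ord0, rshift k j) phi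
        (row_mx (row (rho e) x) (row (tau e) x)))).
rewrite /coupled_sum.
elim: (index_enum _) => [|e r IHr].
  under eq_fun do rewrite big_nil.
  by rewrite big_nil; exact: is_derive_cst.
under eq_fun do rewrite big_cons.
rewrite big_cons; case: ifP => // eE.
by apply: is_deriveD => //; exact: is_derive_edge.
Qed.

(** The coefficients count the edges at [rho e] according to their orientation and
    to the value at the other end; [a > 0] because of [e] itself. *)
Lemma two_valued_partial (u w : 'rV[R]_k) x j e : e \in E ->
  (forall i, row i x = u \/ row i x = w) -> row (rho e) x = u -> row (tau e) x = u ->
  exists a b p q : nat, (0 < a)%N /\
  partial (rho e, j) (coupled_sum E rho tau phi) x =
    a%:R * partial (ord0, lshift k j) phi (row_mx u u) +
    b%:R * partial (ord0, rshift k j) phi (row_mx u u) +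
    (p%:R * partial (ord0, lshift k j) phi (row_mx u w) +
     q%:R * partial (ord0, rshift k j) phi (row_mx w u)).
Proof.
move=> eE xuw rhoe taue; set v := rho e.
exists (\sum_(f in E) ((v == rho f) && (row (tau f) x == u)))%N.
exists (\sum_(f in E) ((v == tau f) && (row (rho f) x == u)))%N.
exists (\sum_(f in E) ((v == rho f) && (row (tau f) x != u)))%N.
exists (\sum_(f in E) ((v == tau f) && (row (rho f) x != u)))%N.
split; first by rewrite (bigD1 e)//= taue !eqxx.
rewrite partial_coupled_sum !natr_sum !mulr_suml -!big_split/=.
apply: eq_bigr => f _.
have xw i : row i x != u -> row i x = w by have [->|//] := xuw i; rewrite eqxx.
rewrite addrACA; congr (_ + _).
  case: eqP => [<-|_]; last by rewrite !mul0r addr0.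
  rewrite -/v rhoe; case: eqVneq => [->|/xw ->] /=; by rewrite !(mul0r, addr0, add0r).
case: eqP => [<-|_]; last by rewrite !mul0r addr0.
rewrite -/v rhoe; case: eqVneq => [->|/xw ->] /=; by rewrite !(mul0r, addr0, add0r).
Qed.

End GraphSums.

Section Bipartitions.
Variables (n : nat) (E : {set {set 'I_n}}).
Hypothesis hE : cell_graph E.

(** A bipartition seen through one of its parts. *)
Definition crosses (V : {set 'I_n}) : Prop :=
  forall u v, edge_rel E u v -> (u \in V) != (v \in V).

Lemma crosses_bipartition V : crosses V -> bipartition E V (~: V).
Proof.
move=> crossV; split=> // e eE.
have [_ card2 _] := hE.
have /eqP/cards2P[u [v [uv e_uv]]] := card2 e eE.
have : (u \in V) != (v \in V) by apply: crossV; rewrite /edge_rel -e_uv.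
have card1 (W : {set 'I_n}) : (u \in W) != (v \in W) -> #|(e :&: W)%SET| = 1%N.
  move=> uvW; apply/eqP/cards1P.
  have vW : (v \in W) = ~~ (u \in W) by case: (u \in W) (v \in W) uvW => [] [].
  case uW: (u \in W) vW => /= vW; [exists u|exists v]; apply/setP => i;
    rewrite !inE e_uv !inE.
    case: (eqVneq i u) => [->|_] //=; case: (eqVneq i v) => [->|_] //=.
  case: (eqVneq i v) => [->|_]; rewrite ?orbT ?vW// orbF.
  by case: (eqVneq i u) => [->|//]; rewrite uW.
move=> uvV; split; apply: card1 => //; rewrite !inE.
by case: (u \in V) (v \in V) uvV => [] [].
Qed.

Lemma bipartition_crosses V1 V2 : bipartition E V1 V2 -> crosses V1.
Proof.
move=> [_ bip] u v uv; have [_ card2 _] := hE.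
have [c1 _] := bip _ uv; apply/negP => /eqP uvV.
have [uV|uV] := boolP (u \in V1).
  have : [set u; v]%SET :&: V1 = [set u; v]%SET.
    by apply/finset.setIidPl/fintype.subsetP => i; rewrite !inE => /orP[]/eqP->;
      rewrite -?uvV.
  by move=> E2; move: c1; rewrite E2 (card2 _ uv).
have : [set u; v]%SET :&: V1 = finset.set0.
  apply/setP => i; rewrite !inE; apply/negbTE/negP => /andP[/orP[]/eqP->]; apply/negP => //.
  by rewrite -uvV.
by move=> E0; move: c1; rewrite E0 cards0.
Qed.

(** Along an edge membership in [V] and in [W] both change, so whether they agree
    is constant on the connected graph. *)
Lemma crosses_unique V W : crosses V -> crosses W -> V = W \/ V = ~: W.
Proof.
move=> cV cW; have [n0 _ conn] := hE; pose v0 := Ordinal n0.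
have cl : fingraph.closed (edge_rel E) [pred i | (i \in V) == (i \in W)].
  move=> u v uv; rewrite !inE; have := cV u v uv; have := cW u v uv.
  by case: (u \in V) (v \in V) (u \in W) (v \in W) => [] [] [] [].
have same i := closed_connect cl (conn v0 i).
case: (boolP ((v0 \in V) == (v0 \in W))) => v0VW; [left|right];
  apply/setP => i; have := same i; rewrite !inE.
  by rewrite v0VW => /esym/eqP.
by rewrite (negbTE v0VW); case: (i \in V) (i \in W) => [] [].
Qed.

End Bipartitions.

(** * The proposition *)

Lemma probe_val_vertex (R : realType) (k : nat) (j0 : 'I_k) (sigma : bool)
    (a b c : nat) (f : 'rV[R]_(k + k) -> R) (x y : 'rV[R]_k) :
  let u := if sigma then x else y in
  probe_val (vertex_probe R j0 sigma a b c) f (row_mx x y) =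
    a%:R * partial (ord0, lshift k j0) f (row_mx u u) +
    b%:R * partial (ord0, rshift k j0) f (row_mx u u) +
    c%:R * partial (ord0, if sigma then rshift k j0 else lshift k j0) f (row_mx y x).
Proof.
rewrite /probe_val /vertex_probe !big_cons big_nil/= !pull_diag pull_swap addr0 addrA.
by case: sigma.
Qed.

Theorem proposition3p5 (R : realType) (n k : nat) (E : {set {set 'I_n}})
    (rho tau : {set 'I_n} -> 'I_n) (S : set ('rV[R]_(k + k) -> R))
    (hk : (0 < k)%N) (hE : cell_graph E) (hrt : edge_endpoints E rho tau)
    (hS : S = setT \/ S = Z2_invariant (R := R) (k := k)) :
  exists2 U : set (smooth_space S), residual U &
    forall phi : smooth_space S, U phi ->
    admissible E (coupled_sum E rho tau phi) ->
    forall x0 y0 : 'rV[R]_k, x0 <> y0 -> critical_point phi (row_mx x0 y0) ->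
    forall x : 'M[R]_(n, k), (forall i, row i x = x0 \/ row i x = y0) ->
    critical_point (coupled_sum E rho tau phi) x ->
    bipartite E /\
    forall V1 V2 : {set 'I_n}, bipartition E V1 V2 ->
      two_valued x0 y0 V1 V2 x \/ two_valued x0 y0 V2 V1 x.
Proof.
pose j0 := Ordinal hk.
have [U rU genU] := generic_vertex_probe j0 hS.
exists U => // phi Uphi _ x0 y0 xy cxy x x_val cx.
have [_ cardE _] := hE; have sphi := smooth_funP phi.
have generic_edge sigma e : e \in E -> let u := if sigma then x0 else y0 in
    row (rho e) x = u -> row (tau e) x = u -> False.
  move=> eE u rhoe taue; pose w := if sigma then y0 else x0.
  have x_uw i : row i x = u \/ row i x = w.
    by rewrite /u /w; have [->|->] := x_val i; case: (sigma); [left|right|right|left].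
  have [a [b [p [q [a0]]]]] :=
    two_valued_partial cardE hrt sphi j0 eE x_uw rhoe taue.
  rewrite cx; set A := partial _ _ _; set B := partial _ _ _ => sum0.
  pose s := if sigma then rshift k j0 else lshift k j0.
  pose D := partial (ord0, s) phi (row_mx y0 x0).
  (* One of the two last terms is a derivative at the critical point and vanishes;
     in the symmetric case the other one does too, which allows [c = 0]. *)
  have [c [Sc cD]] : exists c : nat, (S = setT \/ c = 0%N) /\
      p%:R * partial (ord0, lshift k j0) phi (row_mx u w) +
      q%:R * partial (ord0, rshift k j0) phi (row_mx w u) = c%:R * D.
    have [c cD] : exists c : nat,
      p%:R * partial (ord0, lshift k j0) phi (row_mx u w) +
      q%:R * partial (ord0, rshift k j0) phi (row_mx w u) = c%:R * D.
      rewrite /D /s /u /w; case: (sigma); [exists q|exists p];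
        by rewrite cxy mulr0 ?add0r ?addr0.
    case: hS => [SE|SZ]; [exists c|exists 0%N]; (split; first by [left|right]) => //.
    have phiZ : Z2_invariant phi by rewrite -SZ; exact: smooth_fun_in.
    have D0 : D = 0.
      rewrite /D -pull_swap; have -> : s = swap_idx (swap_idx s) by rewrite swap_idxK.
      by rewrite Z2_partial// cxy.
    by rewrite cD D0 !mulr0.
  have := genU phi Uphi x0 y0 xy cxy sigma a b c a0 Sc.
  by rewrite probe_val_vertex -/u -/A -/B -/D -cD -sum0 eqxx.
pose V := [set i | row i x == x0]%SET.
have y_of i : i \notin V -> row i x = y0.
  by rewrite inE; have [->|//] := x_val i; rewrite eqxx.
have x_of i : i \in V -> row i x = x0 by rewrite inE => /eqP.
have crossV : crosses E V.
  move=> u v uv; apply/negP => /eqP uvV.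
  have := hrt _ uv; set r := rho _; set t := tau _ => uvE.
  have [ru tu] : r \in V = (u \in V) /\ t \in V = (u \in V).
    have : r \in [set u; v]%SET /\ t \in [set u; v]%SET by rewrite uvE !inE !eqxx orbT.
    by rewrite !in_set2 => -[/orP[]/eqP-> /orP[]/eqP->]; rewrite -?uvV.
  case: (boolP (u \in V)) => uV.
    by apply: (generic_edge true _ uv); apply: x_of; rewrite ?ru ?tu.
  by apply: (generic_edge false _ uv); apply: y_of; rewrite ?ru ?tu.
split; first by exists V, (~: V)%SET; exact: crosses_bipartition.
move=> V1 V2 bip; have [V2E _] := bip.
have [V1E|V1E] := crosses_unique hE (bipartition_crosses hE bip) crossV; [left|right].
  by rewrite V2E V1E; split=> i; rewrite ?finset.in_setC; [exact: x_of|exact: y_of].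
rewrite V2E V1E finset.setCK; split=> i; rewrite ?finset.in_setC;
  [exact: x_of|exact: y_of].
Qed.
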